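(* The set $\Omega_2=\{f_0f_0^*\mid f\in F\}$ consists exactly of all those projections $p\in\mathcal{D}_2$ such that $\tau(p)=k/2^{2m+1}$ for some $m\in\mathbb{N}$ and $k\in\mathbb{N}$ with $0<k\leq 2^{2m+1}$ and $k-2$ divisible by $3$.
   Context: Let $\mathcal{O}_2$ be the Cuntz algebra, the unital $C^*$-algebra generated by two isometries $S_1,S_2$ with $S_1S_1^*+S_2S_2^*=1$. Let $W_2$ be the set of all finite words (including the empty word $\emptyset$) in the alphabet $\{1,2\}$, and let $|\mu|$ be the length of $\mu\in W_2$. For $\mu=\mu_1\cdots\mu_k\in W_2$ put $S_\mu=S_{\mu_1}\cdots S_{\mu_k}$ (with $S_\emptyset=1$) and $P_\mu=S_\mu S_\mu^*$. Let $\mathcal{D}_2$ be the $C^*$-subalgebra of $\mathcal{O}_2$ generated by the projections $P_\mu$, $\mu\in W_2$ (it is commutative). Let $\mathcal{F}_2$ be the norm closed span of all $S_\mu S_\nu^*$ with $|\mu|=|\nu|$ (the UHF algebra of type $2^\infty$, containing $\mathcal{D}_2$), and let $\tau$ be its unique normalized trace; thus $\tau(P_\mu)=2^{-|\mu|}$. The Thompson group $F$ is realized as the group of all unitaries in $\mathcal{O}_2$ of the form $f=\sum_{(\alpha,\beta)\in\mathcal{J}}S_\alpha S_\beta^*$, where $\mathcal{J}\subseteq W_2\times W_2$ is a finite set which is the graph of a bijection between its set of first coordinates $\mathcal{J}_1$ and its set of second coordinates $\mathcal{J}_2$, with $\sum_{\alpha\in\mathcal{J}_1}P_\alpha=1=\sum_{\beta\in\mathcal{J}_2}P_\beta$,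 and which is order preserving: for $(\alpha,\beta),(\alpha',\beta')\in\mathcal{J}$, $\alpha$ precedes $\alpha'$ in the lexicographic order if and only if $\beta$ precedes $\beta'$. For $f=\sum_{(\alpha,\beta)\in\mathcal{J}}S_\alpha S_\beta^*\in F$ put $$f_0=\sum_{(\alpha,\beta)\in\mathcal{J},\ |\alpha|-|\beta|\in 2\mathbb{Z}}S_\alpha S_\beta^*$$ (this does not depend on the chosen presentation of $f$); $f_0f_0^*$ is a projection in $\mathcal{D}_2$. *)

(* Defs.v *)
From HB Require Import structures.
From mathcomp Require Import all_boot all_order all_algebra.
From mathcomp Require Import finmap complex.
From mathcomp Require Import all_classical all_reals all_analysis.
Set Implicit Arguments.
Unset Strict Implicit.
Unset Printing Implicit Defensive.
Import Order.TTheory GRing.Theory Num.Theory.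
Import numFieldNormedType.Exports.
Local Open Scope classical_set_scope.
Local Open Scope ring_scope.

(* The product is a field of the mixin because HB cannot join the normed
   modules with the rings (the join would have to precede Num.NumDomain); the
   ring and algebra structures are derived below.  The norm of a normed module
   over R[i] is R[i]-valued: 0 <= `|x| there means real and nonnegative. *)
HB.mixin Record isCStarAlgebra (R : realType) A
    & CompleteNormedModule R[i] A := {
  cstar_one : A;
  cstar_mul : A -> A -> A;
  cstar_mulA : associative cstar_mul;
  cstar_mul1l : left_id cstar_one cstar_mul;
  cstar_mul1r : right_id cstar_one cstar_mul;
  cstar_mulDl : left_distributive cstar_mul +%R;
  cstar_mulDr : right_distributive cstar_mul +%R;
  cstar_oner_neq0 : cstar_one != 0;
  cstar_scaleAl : forall (a : R[i]) (x y : A),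
    a *: cstar_mul x y = cstar_mul (a *: x) y;
  cstar_scaleAr : forall (a : R[i]) (x y : A),
    a *: cstar_mul x y = cstar_mul x (a *: y);
  cstar_normM : forall x y : A, `|cstar_mul x y| <= `|x| * `|y|;
  star : A -> A;
  starK : involutive star;
  starD : {morph star : x y / x + y};
  starZ : forall (a : R[i]) (x : A), star (a *: x) = a^* *: star x;
  starM : forall x y : A, star (cstar_mul x y) = cstar_mul (star y) (star x);
  cstar_norm_star : forall x : A, `|cstar_mul (star x) x| = `|x| ^+ 2
}.

#[short(type="cstarAlgType")]
HB.structure Definition CStarAlgebra (R : realType) :=
  {A of CompleteNormedModule R[i] A & isCStarAlgebra R A}.

Section CStarRing.
Context {R : realType} (A : cstarAlgType R).

HB.instance Definition _ := GRing.Zmodule_isNzRing.Build (CStarAlgebra.sort A)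
  (@cstar_mulA R A) (@cstar_mul1l R A) (@cstar_mul1r R A)
  (@cstar_mulDl R A) (@cstar_mulDr R A) (@cstar_oner_neq0 R A).

HB.instance Definition _ :=
  GRing.Lmodule_isLalgebra.Build R[i] (CStarAlgebra.sort A)
    (@cstar_scaleAl R A).

HB.instance Definition _ :=
  GRing.Lalgebra_isAlgebra.Build R[i] (CStarAlgebra.sort A)
    (@cstar_scaleAr R A).

End CStarRing.

Section CStarNotions.
Context {R : realType} {A : cstarAlgType R}.
Implicit Types (x p u : A) (B X V : set A).

Definition linear_subspace V : Prop :=
  V 0 /\ forall (a : R[i]) x y, V x -> V y -> V (a *: x + y).

Definition linear_span X : set A := smallest linear_subspace X.

Definition cstar_subalgebra B : Prop :=
  [/\ linear_subspace B,
      forall x y, B x -> B y -> B (x * y),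
      forall x, B x -> B (star x)
    & closed B].

Definition cstar_generated X : set A := smallest cstar_subalgebra X.

Definition projection p : Prop := star p = p /\ p * p = p.

Definition unitary u : Prop := star u * u = 1 /\ u * star u = 1.

(* tau is only constrained on B; its values elsewhere are irrelevant. *)
Definition normalized_trace B (tau : A -> R[i]) : Prop :=
  [/\ forall (a : R[i]) x y, B x -> B y -> tau (a *: x + y) = a * tau x + tau y,
      forall x, B x -> 0 <= tau (star x * x),
      tau 1 = 1
    & forall x y, B x -> B y -> tau (x * y) = tau (y * x)].

End CStarNotions.

(* The letters 1, 2 are the elements 0, 1 of 'I_2. *)
Definition word := seq 'I_2.

Definition word_lex_lt (mu nu : word) : bool :=
  ((mu : seqlexi 'I_2) < (nu : seqlexi 'I_2))%O.

Section Cuntz.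
Context {R : realType} {A : cstarAlgType R}.
Variable S : 'I_2 -> A.

Definition is_cuntz2 : Prop :=
  [/\ forall i, star (S i) * S i = 1,
      \sum_i S i * star (S i) = 1
    & cstar_generated (range S) = setT].

Definition Sword (mu : word) : A := \prod_(i <- mu) S i.

Definition Pword (mu : word) : A := Sword mu * star (Sword mu).

Definition D2 : set A := cstar_generated (range Pword).

Definition F2 : set A :=
  closure (linear_span
    [set Sword w.1 * star (Sword w.2) | w in [set w : word * word |
                                              size w.1 = size w.2]]).

Implicit Types (J : {fset word * word}) (f : A).

Definition table_sum J : A := \sum_(w <- J) Sword w.1 * star (Sword w.2).

Definition table_even_sum J : A :=
  \sum_(w <- J | (2 %| (size w.1)%:Z - (size w.2)%:Z)%Z)
    Sword w.1 * star (Sword w.2).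

Definition thompson_table J : Prop :=
  [/\ {in J &, forall w w', w.1 = w'.1 <-> w.2 = w'.2},
      \sum_(mu <- [fset w.1 | w in J]%fset) Pword mu = 1,
      \sum_(mu <- [fset w.2 | w in J]%fset) Pword mu = 1
    & {in J &, forall w w', word_lex_lt w.1 w'.1 = word_lex_lt w.2 w'.2}].

Definition presents J f : Prop := thompson_table J /\ f = table_sum J.

Definition thompsonF : set A :=
  [set f | unitary f /\ exists J, presents J f].

(* f_0, read off from some presentation of f; the value does not depend on
   which one, and the default 0 is only used outside thompsonF. *)
Definition even_part f : A :=
  xget 0 [set table_even_sum J | J in [set J | presents J f]].

Definition Omega2 : set A :=
  [set even_part f * star (even_part f) | f in thompsonF].

End Cuntz.

(* Main.v *)
(* Modulo 3 the ring Z[1/2] satisfies 2^-l = (-1)^l, so if E and O denote the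
   traces of the even and odd parts of the range partition of f, the two
   partitions of unity give E + O = 1 = E - O, hence E = 1 modulo 3.
   Conversely, a projection of the diagonal algebra is a sum of P_w over a set M
   of words of some even length.  Take as first coordinates the words of M and
   both children of the words of that length outside M: the trace condition
   makes their number congruent to 1 modulo 3, which is the number of leaves of a
   4-ary tree, all of whose leaves have even depth.  Matching the two lists in
   lexicographic order gives an element of F whose even part has range P_M. *)
Require Import Defs.
From mathcomp Require Import all_boot all_order all_algebra.
From mathcomp Require Import finmap complex.
From mathcomp Require Import all_classical all_reals all_analysis.
From mathcomp Require Import zify ring.
Set Implicit Arguments.
Unset Strict Implicit.
Unset Printing Implicit Defensive.
Import Order.TTheory GRing.Theory Num.Theory.
Import numFieldNormedType.Exports.
Local Open Scope classical_set_scope.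
Local Open Scope ring_scope.

(** * Norm estimates and closures in a C*-algebra *)

Section CStarTheory.
Context {R : realType} {A : cstarAlgType R}.
Implicit Types (x y p e : A) (c : R[i]).

Lemma starMr x y : star (x * y) = star y * star x.
Proof. exact: starM. Qed.

Lemma star0 : star (0 : A) = 0.
Proof. by apply: (addIr (star 0)); rewrite -starD !add0r. Qed.

Lemma starB x y : star (x - y) = star x - star y.
Proof. by rewrite starD -scaleN1r starZ rmorphN1 scaleN1r. Qed.

Lemma star1 : star (1 : A) = 1.
Proof. by have := starMr (star 1) 1; rewrite mulr1 starK mulr1. Qed.

Lemma star_sum (I : Type) (r : seq I) (P : pred I) (F : I -> A) :
  star (\sum_(i <- r | P i) F i) = \sum_(i <- r | P i) star (F i).
Proof. exact: (big_morph (@star R A) (@starD R A) star0). Qed.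

Lemma normM_le x y : `|x * y| <= `|x| * `|y|.
Proof. exact: cstar_normM. Qed.

Lemma norm_starM x : `|star x * x| = `|x| ^+ 2.
Proof. exact: cstar_norm_star. Qed.

Lemma norm_star x : `|star x| = `|x|.
Proof.
suff le y : `|y| <= `|star y|.
  by apply/eqP; rewrite eq_le le andbT -{2}[x]starK le.
have [->|y0] := eqVneq `|y| 0; first exact: normr_ge0.
have y_gt0 : 0 < `|y| by rewrite lt_def y0 normr_ge0.
by rewrite -(ler_pM2r y_gt0) -expr2 -norm_starM normM_le.
Qed.

Lemma norm_projection e : projection e -> e != 0 -> `|e| = 1.
Proof.
move=> [es ee]; rewrite -normr_eq0 => e0; apply: (mulIf e0).
by rewrite mul1r -expr2 -norm_starM es ee.
Qed.

Lemma projection_norm_le1 e : projection e -> `|e| <= 1.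
Proof.
move=> pe; have [->|/(norm_projection pe) ->//] := eqVneq e 0.
by rewrite normr0 ler01.
Qed.

(** If [e] and [p - e] were both nonzero, they would have norm 1, and multiplying [e - c *: p] by
    each of them would give |1 - c| < 1/2 and |c| < 1/2, against the triangle inequality. *)
Lemma projection_near_scalar e p c :
  projection e -> projection p -> e * p = e -> p * e = e ->
  `|e - c *: p| < 2^-1 -> e = 0 \/ e = p.
Proof.
move=> pe pp ep pq near; have [->|e0] := eqVneq e 0; first by left.
have [->|ne] := eqVneq e p; first by right.
have pq' : projection (p - e).
  case: pe pp => es ee [ps ppp]; split; first by rewrite starB es ps.
  by rewrite mulrBr !mulrBl ppp ep pq ee subrr subr0.
have h1 : `|1 - c| < 2^-1.
  apply: le_lt_trans near.
  have -> : `|1 - c| = `|e * (e - c *: p)|.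
    rewrite mulrBr -scalerAr ep (proj2 pe) -{1}[e]scale1r -scalerBl normrZ.
    by rewrite (norm_projection pe e0) mulr1.
  by apply: le_trans (normM_le _ _) _; rewrite (norm_projection pe e0) mul1r.
have h2 : `|c| < 2^-1.
  apply: le_lt_trans near.
  have d0 : p - e != 0 by rewrite subr_eq0 eq_sym.
  have -> : `|c| = `|(p - e) * (e - c *: p)|.
    rewrite mulrBr -scalerAr mulrBl pq (proj2 pe) subrr mulrBl ep (proj2 pp).
    by rewrite sub0r normrN normrZ (norm_projection pq' d0) mulr1.
  by apply: le_trans (normM_le _ _) _; rewrite (norm_projection pq' d0) mul1r.
have := ltrD h1 h2; rewrite -[2^-1]mul1r -splitr => lt1.
suff: 1 < 1 :> R[i] by rewrite ltxx.
by apply: le_lt_trans lt1; rewrite -{1}[1]normr1 -{1}[1](subrK c) ler_normD.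
Qed.

Lemma closure_normP (B : set A) x :
  closure B x <-> forall eps : R[i], 0 < eps -> exists2 y, B y & `|x - y| < eps.
Proof.
split=> [cB eps e0|h U /nbhs_ballP[e /= e0 sub]].
  have [y [By]] := cB _ (nbhsx_ballx x _ e0).
  by rewrite -ball_normE /= => ?; exists y.
have [y By xy] := h _ e0; exists y; split=> //; apply: sub.
by rewrite -ball_normE.
Qed.

Lemma image_closure_sub (B C : set A) (f : A -> A) c :
  closed C -> (forall x y, `|f x - f y| <= c * `|x - y|) ->
  (forall x, B x -> C (f x)) -> forall x, closure B x -> C (f x).
Proof.
move=> /closure_id clC lip BC x /closure_normP cx; rewrite clC.
apply/closure_normP => eps e0.
(* The Lipschitz constant [c] may be zero, so it is enlarged to one that can be divided by. *)
have c'0 : 0 < `|c| + 1 by rewrite ltr_wpDl.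
have [y By xy] := cx _ (divr_gt0 e0 c'0).
exists (f y); first by apply/BC.
have lipn : `|f x - f y| <= (`|c| + 1) * `|x - y|.
  apply: le_trans (lip x y) _; have := lip x y.
  have [->|nz] := eqVneq `|x - y| 0; first by rewrite !mulr0.
  have p0 : 0 < `|x - y| by rewrite lt_def nz normr_ge0.
  move=> h; apply: ler_wpM2r => //; have : 0 <= c.
    by rewrite -(pmulr_lge0 c p0); apply: le_trans h.
  by move=> /ger0_norm ->; rewrite lerDl ler01.
by apply: le_lt_trans lipn _; rewrite mulrC -ltr_pdivlMr.
Qed.

(** Each operation passes to the closure by [image_closure_sub]; binary ones are extended one
    argument at a time, the other argument being held fixed first in [B], then in the closure. *)
Lemma cstar_subalgebra_closure (B : set A) :
  linear_subspace B -> (forall x y, B x -> B y -> B (x * y)) ->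
  (forall x, B x -> B (star x)) -> cstar_subalgebra (closure B).
Proof.
move=> [B0 BL] BM BS.
have cB : closed (closure B) by exact: closed_closure.
have sB : B `<=` closure B by exact: subset_closure.
have BD x y : B x -> B y -> B (x + y).
  by move=> Bx By; rewrite -[x]scale1r; apply: BL.
have BZ a x : B x -> B (a *: x) by move=> Bx; rewrite -[_ *: _]addr0; apply: BL.
have cBZ a x : closure B x -> closure B (a *: x).
  apply: (image_closure_sub (c := `|a|)) => //.
    by move=> u v; rewrite -scalerBr normrZ.
  by move=> z Bz; apply/sB/BZ.
have cBD x y : closure B x -> closure B y -> closure B (x + y).
  have cBDl u : B u -> forall v, closure B v -> closure B (v + u).
    move=> Bu; apply: (image_closure_sub (c := 1)) => //.
      by move=> v w; rewrite mul1r opprD addrACA subrr addr0.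
    by move=> v Bv; apply/sB/BD.
  move=> cx; apply: (image_closure_sub (c := 1)) => //.
    by move=> v w; rewrite mul1r opprD addrACA subrr add0r.
  by move=> v Bv; apply: cBDl.
split=> //.
- by split=> [|a x y cx cy]; [apply: sB|apply: cBD => //; apply: cBZ].
- have cBMl u : B u -> forall v, closure B v -> closure B (v * u).
    move=> Bu; apply: (image_closure_sub (c := `|u|)) => //.
      by move=> v w; rewrite -mulrBl mulrC; apply: normM_le.
    by move=> v Bv; apply/sB/BM.
  move=> x y cx; move: y; apply: (image_closure_sub (c := `|x|)) => //.
    by move=> v w; rewrite -mulrBr; apply: normM_le.
  by move=> v Bv; apply: cBMl.
- apply: (image_closure_sub (c := 1)) => //.
    by move=> v w; rewrite mul1r -starB norm_star.
  by move=> v Bv; apply/sB/BS.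
Qed.

End CStarTheory.

(** * Words and cylinder projections *)

Section CuntzWords.
Context {R : realType} {A : cstarAlgType R} (S : 'I_2 -> A).
Context (hS : is_cuntz2 S).
Implicit Types (u v w : word) (i j : 'I_2).

Local Notation Sw := (Sword S).
Local Notation P := (Pword S).

(** For i != j the two indices exhaust ['I_2]; multiplying the sum relation by S_i^* on the left and
    S_j on the right gives x = x + x for x = S_i^* S_j. *)
Lemma generator_ortho i j : star (S i) * S j = (i == j)%:R.
Proof.
have [SS sum1 _] := hS; have [->|nij] := eqVneq i j; first exact: SS.
have := congr1 (fun x => star (S i) * x * S j) sum1.
have -> : \sum_k S k * star (S k) = S i * star (S i) + S j * star (S j).
  rewrite (bigD1 i) //= (bigD1 j) 1?eq_sym //= big1 ?addr0 // => k /andP[].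
  move: nij; case: i j k => [[|[|?]] ?] [[|[|?]] ?] [[|[|?]] ?] //.
rewrite mulr1 mulrDr mulrDl mulrA SS mul1r -mulrA -(mulrA (S j)) SS mulr1.
by move=> /eqP; rewrite -subr_eq0 addrAC subrr add0r => /eqP.
Qed.

Lemma Sword_nil : Sw [::] = 1.
Proof. exact: big_nil. Qed.

Lemma Sword_cons i w : Sw (i :: w) = S i * Sw w.
Proof. exact: big_cons. Qed.

Lemma Sword_cat u v : Sw (u ++ v) = Sw u * Sw v.
Proof. exact: big_cat. Qed.

Lemma Sword_isometry w : star (Sw w) * Sw w = 1.
Proof.
elim: w => [|i w IH]; first by rewrite Sword_nil star1 mulr1.
rewrite Sword_cons starMr mulrA -(mulrA (star _)) generator_ortho eqxx mulr1.
exact: IH.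
Qed.

(** Equal first letters cancel and different ones give 0, so the cases are: incomparable words, [u]
    a prefix of [v], [v] a prefix of [u]. *)
Lemma star_Sword_mul u v :
  [\/ star (Sw u) * Sw v = 0,
      exists2 w, v = u ++ w & star (Sw u) * Sw v = Sw w
    | exists2 w, u = v ++ w & star (Sw u) * Sw v = star (Sw w)].
Proof.
elim: u v => [|i u IH] [|j v].
- by apply: Or32; exists [::]; rewrite // Sword_nil star1 mulr1.
- by apply: Or32; exists (j :: v); rewrite // Sword_nil star1 mul1r.
- by apply: Or33; exists (i :: u); rewrite // Sword_nil mulr1.
rewrite !Sword_cons starMr mulrA -(mulrA (star (Sw u))) generator_ortho.
have [<-|_] := eqVneq i j; last by apply: Or31; rewrite mulr0 mul0r.
rewrite mulr1; case: (IH v) => [->|[w -> ->]|[w -> ->]].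
- exact: Or31.
- by apply: Or32; exists w.
- by apply: Or33; exists w.
Qed.

Lemma Sword_ortho u v : size u = size v -> star (Sw u) * Sw v = (u == v)%:R.
Proof.
have [-> _|nuv suv] := eqVneq u v; first exact: Sword_isometry.
case: (star_Sword_mul u v) => // -[[|k w] e _]; move: nuv suv; rewrite e.
- by rewrite cats0 eqxx.
- by rewrite size_cat /= => _; lia.
- by rewrite cats0 eqxx.
- by rewrite size_cat /= => _; lia.
Qed.

Lemma Pword_nil : P [::] = 1.
Proof. by rewrite /Pword Sword_nil star1 mulr1. Qed.

Lemma Pword_cat u v : P (u ++ v) = Sw u * P v * star (Sw u).
Proof. by rewrite /Pword Sword_cat starMr !mulrA. Qed.

Lemma Pword_projection w : projection (P w).
Proof.
split; first by rewrite /Pword starMr starK.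
by rewrite /Pword mulrA -(mulrA (Sw w)) Sword_isometry mulr1.
Qed.

Lemma PwordM u v : [\/ P u * P v = 0, P u * P v = P u | P u * P v = P v].
Proof.
have -> : P u * P v = Sw u * (star (Sw u) * Sw v) * star (Sw v).
  by rewrite /Pword !mulrA.
case: (star_Sword_mul u v) => [->|[w -> ->]|[w -> ->]].
- by rewrite mulr0 mul0r; apply: Or31.
- by apply: Or33; rewrite /Pword Sword_cat.
- by apply: Or32; rewrite /Pword Sword_cat -mulrA -starMr -Sword_cat.
Qed.

Lemma Pword_ortho u v : size u = size v -> P u * P v = (u == v)%:R * P u.
Proof.
move=> /Sword_ortho uv; have [->|nuv] := eqVneq u v.
  by rewrite mul1r (proj2 (Pword_projection v)).
by rewrite /Pword mulrA -(mulrA (Sw u)) uv (negPf nuv) mulr0 !mul0r.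
Qed.

Lemma Pword_split w : P w = \sum_i P (rcons w i).
Proof.
have [_ sum1 _] := hS.
transitivity (Sw w * (\sum_i S i * star (S i)) * star (Sw w)).
  by rewrite sum1 mulr1.
rewrite mulr_sumr mulr_suml; apply: eq_bigr => i _.
by rewrite -cats1 Pword_cat /Pword Sword_cons Sword_nil mulr1.
Qed.

(** Words grow at the right end, so that the step from [n] to [n.+1] is the splitting of every
    cylinder by [Pword_split]. *)
Fixpoint words n : seq word :=
  if n is m.+1 then [seq rcons w i | w <- words m, i <- enum 'I_2]
  else [:: [::]].

Lemma size_mem_words n w : w \in words n -> size w = n.
Proof.
elim: n w => [|n IH] w; first by rewrite inE => /eqP ->.
by move=> /allpairsP[[v i] /= [/IH sv _ ->]]; rewrite size_rcons sv.
Qed.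

Lemma words_uniq n : uniq (words n).
Proof.
elim: n => //= n IH; apply: allpairs_uniq (enum_uniq _) _ => //.
by move=> [u i] [v j] _ _ /= /rcons_inj[-> ->].
Qed.

Lemma size_words n : size (words n) = (2 ^ n)%N.
Proof.
by elim: n => //= n IH; rewrite size_allpairs IH size_enum_ord expnSr.
Qed.

Lemma sum_words_S n (V : nmodType) (F : word -> V) :
  \sum_(w <- words n.+1) F w = \sum_(w <- words n) \sum_i F (rcons w i).
Proof.
by rewrite /= big_allpairs_dep; apply: eq_bigr => w _; rewrite big_enum.
Qed.

Lemma sum_Pword_words n : \sum_(w <- words n) P w = 1.
Proof.
elim: n => [|n IH]; first by rewrite big_seq1 Pword_nil.
by rewrite sum_words_S -IH; apply: eq_bigr => w _; rewrite -Pword_split.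
Qed.

(** * The trace on cylinder projections *)

Section Trace.
Context (tau : A -> R[i]).
Context (htau : normalized_trace (F2 S) tau).

(** Linearity of [tau] is available on [F2 S] only. Membership is tracked in the algebraic span of
    these generators, which contains the cylinder projections and their products. *)
Let F2gen : set A :=
  [set Sw w.1 * star (Sw w.2) | w in [set w : word * word |
                                              size w.1 = size w.2]].

Lemma F2_span x : linear_span F2gen x -> F2 S x.
Proof. exact: subset_closure. Qed.

Lemma linear_span_subspace (X : set A) : linear_subspace (linear_span X).
Proof.
split=> [|a x y Xx Xy] V XV; have [[V0 VL] _] := XV; first exact: V0.
by apply: VL; [apply: Xx|apply: Xy].
Qed.

Lemma Pword_span w : linear_span F2gen (P w).
Proof. by apply: sub_gen_smallest; exists (w, w). Qed.

Lemma PwordM_span u v : linear_span F2gen (P u * P v).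
Proof.
case: (PwordM u v) => ->; try exact: Pword_span.
exact: (proj1 (linear_span_subspace _)).
Qed.

Lemma tau0 : tau 0 = 0.
Proof.
have [lin _ _ _] := htau; have F0 := F2_span (proj1 (linear_span_subspace _)).
have := lin 1 0 0 F0 F0; rewrite scaler0 addr0 mul1r => /eqP.
by rewrite -{1}[tau 0]addr0 (inj_eq (addrI _)) eq_sym => /eqP.
Qed.

Lemma tau_sum (I : Type) (r : seq I) (Q : pred I) (F : I -> A) :
  (forall k, linear_span F2gen (F k)) ->
  tau (\sum_(k <- r | Q k) F k) = \sum_(k <- r | Q k) tau (F k).
Proof.
have [lin _ _ _] := htau; have [sp0 spD] := linear_span_subspace F2gen => FG.
suff [] : tau (\sum_(k <- r | Q k) F k) = \sum_(k <- r | Q k) tau (F k) /\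
  linear_span F2gen (\sum_(k <- r | Q k) F k) by [].
elim: r => [|k r [IH1 IH2]]; first by rewrite !big_nil tau0.
rewrite !big_cons; case: (Q k) => //; split.
  by rewrite -[F k]scale1r lin ?scale1r ?mul1r ?IH1//; apply: F2_span.
by rewrite -[F k]scale1r; apply: spD.
Qed.

(** For words of equal length, S_u S_w^* lies in [F2 S] and conjugates P_w into P_u, so the trace
    property equates their traces; these 2^n equal values add up to 1. *)
Lemma tau_Pword w : tau (P w) = 2 ^- size w.
Proof.
have [_ _ tau1 tauC] := htau.
have tauE u : u \in words (size w) -> tau (P u) = tau (P w).
  move=> /size_mem_words su.
  have F2uv v v' : size v = size v' -> F2 S (Sw v * star (Sw v')).
    by move=> e; apply: F2_span; apply: sub_gen_smallest; exists (v, v').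
  have -> : P u = (Sw u * star (Sw w)) * (Sw w * star (Sw u)).
    by rewrite mulrA -(mulrA (Sw u)) Sword_isometry mulr1.
  rewrite tauC; do ?exact: F2uv.
  by rewrite mulrA -(mulrA (Sw w)) Sword_isometry mulr1.
have := tau1; rewrite -(sum_Pword_words (size w)) tau_sum;
  last exact: Pword_span.
rewrite (eq_big_seq _ tauE) big_const_seq count_predT size_words iter_addr_0.
move=> h; apply: (mulIf (x := 2 ^+ size w)).
  by rewrite expf_neq0 // pnatr_eq0.
by rewrite mulVf ?expf_neq0 ?pnatr_eq0 // -natrX mulr_natr.
Qed.

Lemma tau_Pword_gt0 w : 0 < tau (P w).
Proof. by rewrite tau_Pword invr_gt0 exprn_gt0. Qed.

(** Multiplying the partition by P_u and taking traces shows that the traces of P_u P_w for w != u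
    add up to 0. Each such product is 0, P_u or P_w, hence has nonnegative trace, and zero trace
    only if it vanishes. *)
Lemma partition_ortho (L : seq word) : uniq L -> \sum_(w <- L) P w = 1 ->
  {in L &, forall u v, star (Sw u) * Sw v = (u == v)%:R}.
Proof.
move=> uL sL u v uinL vinL; have [->|nuv] := eqVneq u v.
  exact: Sword_isometry.
have ge0 w : 0 <= tau (P u * P w).
  by case: (PwordM u w) => ->; rewrite ?tau0 // ltW // tau_Pword_gt0.
have : \sum_(w <- L | w != u) tau (P u * P w) == 0.
  have : tau (P u * \sum_(w <- L) P w) = tau (P u) by rewrite sL mulr1.
  rewrite mulr_sumr tau_sum => [|w]; last exact: PwordM_span.
  rewrite (bigD1_seq u) //= (proj2 (Pword_projection u)) => /eqP.
  by rewrite -subr_eq0 addrAC subrr add0r.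
rewrite psumr_eq0 // => /allP/(_ v vinL); rewrite eq_sym nuv /= => tuv.
have uv0 : P u * P v = 0.
  case: (PwordM u v) => // e; move: tuv; rewrite e => /eqP t0.
    by have := tau_Pword_gt0 u; rewrite t0 ltxx.
  by have := tau_Pword_gt0 v; rewrite t0 ltxx.
have -> : star (Sw u) * Sw v = star (Sw u) * (P u * P v) * Sw v.
  by rewrite /Pword !mulrA Sword_isometry mul1r -mulrA Sword_isometry mulr1.
by rewrite uv0 mulr0 mul0r.
Qed.

(* The tau-values of x x^* and x^* x detect the degree |v| - |u| of the
   partial isometry x = S_u^* S_v. *)
Lemma star_Sword_mul_degree u v (x := star (Sw u) * Sw v) : x != 0 ->
  [/\ 0 < tau (x * star x), 0 < tau (star x * x) &
      tau (x * star x) * 2 ^+ size v = tau (star x * x) * 2 ^+ size u].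
Proof.
have [_ _ tau1 _] := htau.
rewrite /x; case: (star_Sword_mul u v) => [->|[w -> ->] _|[w -> ->] _].
- by rewrite eqxx.
- rewrite Sword_isometry tau1 -/(P w) tau_Pword_gt0 ltr01 tau_Pword size_cat.
  by rewrite exprD mulrCA mulVf ?expf_neq0 ?pnatr_eq0 // mulr1 mul1r.
- rewrite starK Sword_isometry tau1 -/(P w) tau_Pword_gt0 ltr01 tau_Pword.
  by rewrite size_cat exprD mulrCA mulVf ?expf_neq0 ?pnatr_eq0 // mulr1 mul1r.
Qed.

(** The degree is an invariant of the element: the trace identities for both expressions are
    multiplied crosswise and the positive traces cancelled. *)
Lemma star_Sword_mul_eq_size u v u' v' :
  star (Sw u) * Sw v != 0 -> star (Sw u) * Sw v = star (Sw u') * Sw v' ->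
  (size u + size v' = size u' + size v)%N.
Proof.
move=> nz e; have := star_Sword_mul_degree nz; move: nz; rewrite e.
move=> /star_Sword_mul_degree.
move: (tau _) (tau _) => b a [a0 b0 e1] [_ _ e2].
have h : a * b * 2 ^+ (size u + size v') = a * b * 2 ^+ (size u' + size v).
  rewrite !exprD mulrACA -mulrA [b * _]mulrC.
  transitivity ((a * 2 ^+ size v') * (b * 2 ^+ size u)); first by ring.
  by rewrite e1 -e2; ring.
have := mulfI (mulf_neq0 (lt0r_neq0 a0) (lt0r_neq0 b0)) h.
by rewrite -!natrX => /eqP; rewrite eqr_nat eqn_exp2l // => /eqP.
Qed.

(** * Presentations of Thompson group elements *)

Implicit Types (t : word * word) (J : {fset word * word}) (f : A).

Local Notation even_pair t := (2 %| (size t.1)%:Z - (size t.2)%:Z)%Z.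

Lemma even_pairE (t : word * word) :
  even_pair t = (odd (size t.1) == odd (size t.2)).
Proof. by rewrite dvdzE /=; lia. Qed.

Lemma table_fst_inj J :
  {in J &, forall t t', t.1 = t'.1 <-> t.2 = t'.2} ->
  {in J &, injective fst}.
Proof.
move=> bij [a b] [a' b'] tinJ t'inJ /= e.
by congr pair => //; apply/(bij _ _ tinJ t'inJ).
Qed.

Lemma table_snd_inj J :
  {in J &, forall t t', t.1 = t'.1 <-> t.2 = t'.2} ->
  {in J &, injective snd}.
Proof.
move=> bij [a b] [a' b'] tinJ t'inJ /= e.
by congr pair => //; apply/(bij _ _ tinJ t'inJ).
Qed.

Lemma perm_table_fst J :
  {in J &, forall t t', t.1 = t'.1 <-> t.2 = t'.2} ->
  perm_eq [fset t.1 | t in J]%fset [seq t.1 | t <- J].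
Proof. by move=> /table_fst_inj inj; apply: enum_imfset. Qed.

Lemma perm_table_snd J :
  {in J &, forall t t', t.1 = t'.1 <-> t.2 = t'.2} ->
  perm_eq [fset t.2 | t in J]%fset [seq t.2 | t <- J].
Proof. by move=> /table_snd_inj inj; apply: enum_imfset. Qed.

Lemma table_sum_fst J : thompson_table S J -> \sum_(t <- J) P t.1 = 1.
Proof.
by case=> /perm_table_fst pJ <- _ _; rewrite (perm_big _ pJ) big_map.
Qed.

Lemma table_sum_snd J : thompson_table S J -> \sum_(t <- J) P t.2 = 1.
Proof.
by case=> /perm_table_snd pJ _ <- _; rewrite (perm_big _ pJ) big_map.
Qed.

Lemma table_ortho_fst J : thompson_table S J ->
  {in J &, forall t t', star (Sw t.1) * Sw t'.1 = (t == t')%:R}.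
Proof.
move=> [bij s1 _ _] t t' tinJ t'J.
rewrite (partition_ortho _ s1) ?fset_uniq //.
- by rewrite (inj_in_eq (table_fst_inj bij)).
- by rewrite in_imfset.
- by rewrite in_imfset.
Qed.

Lemma table_ortho_snd J : thompson_table S J ->
  {in J &, forall t t', star (Sw t.2) * Sw t'.2 = (t == t')%:R}.
Proof.
move=> [bij _ s2 _] t t' tinJ t'J.
rewrite (partition_ortho _ s2) ?fset_uniq //.
- by rewrite (inj_in_eq (table_snd_inj bij)).
- by rewrite in_imfset.
- by rewrite in_imfset.
Qed.

Lemma sum_delta (L : seq (word * word)) (Q : pred (word * word))
    (F : word * word -> A) t : uniq L -> t \in L ->
  \sum_(t' <- L | Q t') (t == t')%:R * F t' = if Q t then F t else 0.
Proof.
move=> uL wL; rewrite big_mkcond (bigD1_seq t) //= eqxx mul1r big1 ?addr0 //.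
by move=> t'; rewrite eq_sym => /negPf ->; rewrite mul0r if_same.
Qed.

(** Orthogonality of the second coordinates kills the cross terms. A general [Q] covers both the
    unitarity of the full sum and the range projection of the even part. *)
Lemma table_sub_mul_star J (Q : pred (word * word)) : thompson_table S J ->
  let g := \sum_(t <- J | Q t) Sw t.1 * star (Sw t.2) in
  g * star g = \sum_(t <- J | Q t) P t.1.
Proof.
move=> tJ /=; rewrite star_sum mulr_suml big_seq_cond [RHS]big_seq_cond.
apply: eq_bigr => t /andP[tinJ Qw]; rewrite mulr_sumr.
transitivity (\sum_(t' <- J | Q t') (t == t')%:R * (Sw t.1 * star (Sw t'.1))).
  rewrite big_seq_cond [RHS]big_seq_cond; apply: eq_bigr => t' /andP[t'J _].
  rewrite starMr starK mulrA -(mulrA (Sw t.1)) (table_ortho_snd tJ) //.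
  by case: eqP => _; rewrite ?mulr1 ?mul1r // mulr0 !mul0r.
by rewrite sum_delta ?fset_uniq // Qw.
Qed.

Lemma table_sub_star_mul J (Q : pred (word * word)) : thompson_table S J ->
  let g := \sum_(t <- J | Q t) Sw t.1 * star (Sw t.2) in
  star g * g = \sum_(t <- J | Q t) P t.2.
Proof.
move=> tJ /=; rewrite star_sum mulr_suml big_seq_cond [RHS]big_seq_cond.
apply: eq_bigr => t /andP[tinJ Qw]; rewrite mulr_sumr.
transitivity (\sum_(t' <- J | Q t') (t == t')%:R * (Sw t.2 * star (Sw t'.2))).
  rewrite big_seq_cond [RHS]big_seq_cond; apply: eq_bigr => t' /andP[t'J _].
  rewrite starMr starK mulrA -(mulrA (Sw t.2)) (table_ortho_fst tJ) //.
  by case: eqP => _; rewrite ?mulr1 ?mul1r // mulr0 !mul0r.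
by rewrite sum_delta ?fset_uniq // Qw.
Qed.

Lemma table_sum_mul_Sword J t : thompson_table S J -> t \in J ->
  table_sum S J * Sw t.2 = Sw t.1.
Proof.
move=> tJ tinJ; rewrite /table_sum mulr_suml.
transitivity (\sum_(t' <- J) (t == t')%:R * Sw t'.1).
  rewrite big_seq [RHS]big_seq; apply: eq_bigr => t' t'J.
  rewrite -mulrA (table_ortho_snd tJ) // eq_sym.
  by case: eqP => _; rewrite ?mulr1 ?mul1r // mulr0 mul0r.
by rewrite sum_delta ?fset_uniq.
Qed.

Lemma Sword_mul_table_sum J t : thompson_table S J -> t \in J ->
  star (Sw t.1) * table_sum S J = star (Sw t.2).
Proof.
move=> tJ tinJ; rewrite /table_sum mulr_sumr.
transitivity (\sum_(t' <- J) (t == t')%:R * star (Sw t'.2)).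
  rewrite big_seq [RHS]big_seq; apply: eq_bigr => t' t'J.
  by rewrite mulrA (table_ortho_fst tJ).
by rewrite sum_delta ?fset_uniq.
Qed.

(* Expanding both even sums over J x J', the (t, t') terms agree: they are
   S_{t.1} (S_{t.2}^* S_{t'.2}) S_{t'.2}^*, and when this is nonzero t and t'
   have the same degree. *)
Lemma table_even_sum_uniq J J' f : presents S J f -> presents S J' f ->
  table_even_sum S J = table_even_sum S J'.
Proof.
move=> [tJ fJ] [tJ' fJ'].
(* Both sides are S_{t.1}^* f S_{t'.2}, with [f] absorbed to the left through [J] or to the right
   through [J']. *)
have conn t t' : t \in J -> t' \in J' ->
    star (Sw t.2) * Sw t'.2 = star (Sw t.1) * Sw t'.1.
  move=> tinJ t'J'; rewrite -(Sword_mul_table_sum tJ tinJ) -fJ fJ' -mulrA.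
  by rewrite table_sum_mul_Sword.
have -> : table_even_sum S J = \sum_(t <- J) \sum_(t' <- J')
    if even_pair t then Sw t.1 * (star (Sw t.2) * Sw t'.2) * star (Sw t'.2)
      else 0.
  rewrite /table_even_sum big_mkcond; apply: eq_bigr => t _.
  case: ifP => _; last by rewrite big1.
  rewrite -[LHS]mulr1 -(table_sum_snd tJ') mulr_sumr.
  by apply: eq_bigr => t' _; rewrite /Pword !mulrA.
have -> : table_even_sum S J' = \sum_(t <- J) \sum_(t' <- J')
    if even_pair t' then Sw t.1 * (star (Sw t.1) * Sw t'.1) * star (Sw t'.2)
      else 0.
  rewrite exchange_big /table_even_sum big_mkcond; apply: eq_bigr => t' _ /=.
  case: ifP => _; last by rewrite big1.
  rewrite -[LHS]mul1r -(table_sum_fst tJ) mulr_suml.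
  by apply: eq_bigr => t _; rewrite /Pword !mulrA.
rewrite big_seq [RHS]big_seq; apply: eq_bigr => t tinJ.
rewrite big_seq [RHS]big_seq; apply: eq_bigr => t' t'J'.
have cn := conn _ _ tinJ t'J'; rewrite -cn.
have [->|nz] := eqVneq (star (Sw t.2) * Sw t'.2) 0.
  by rewrite mulr0 mul0r !if_same.
have := congr1 odd (star_Sword_mul_eq_size nz cn).
by rewrite !even_pairE !oddD; do 4!case: (odd _).
Qed.

(** The choice made by [xget] is harmless by [table_even_sum_uniq], and [J] itself rules out the
    default value. *)
Lemma even_part_table J f :
  presents S J f -> even_part S f = table_even_sum S J.
Proof.
move=> pJ; rewrite /even_part.
have [|J' pJ' <-] := @xgetPex _ (0 : A)
    [set table_even_sum S J | J in [set J | presents S J f]].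
  by exists (table_even_sum S J), J.
exact: table_even_sum_uniq pJ' pJ.
Qed.

(** * The trace of the even part modulo 3 *)

Lemma expn2_mod3 n : (2 ^ n %% 3 = if odd n then 2 else 1)%N.
Proof.
elim: n => // n IH; rewrite expnS -modnMmr IH /=.
by case: (odd n).
Qed.

(** Since 2 = -1 modulo 3, powers with exponents of opposite parity cancel and powers with exponents
    of equal parity agree. *)
Lemma expn2D_mod3 a b :
  (2 ^ a + 2 ^ b = if odd a == odd b then 2 * 2 ^ a else 0 %[mod 3])%N.
Proof.
rewrite -modnDm; have := modnMm 2 (2 ^ a) 3; rewrite !expn2_mod3.
by case: (odd a); case: (odd b) => //= ->.
Qed.

Lemma dvdz3_sub2 k : (3 %| k%:Z - 2)%Z = (k %% 3 == 2)%N.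
Proof. by rewrite -eqz_mod_dvd; lia. Qed.

(** The common denominator 2^N turns statements about traces into congruences between natural
    numbers. *)
Lemma tau_sum_Pword (I : eqType) (L : seq I) (Q : pred I) (F : I -> word) N :
  (forall k, k \in L -> size (F k) <= N)%N ->
  tau (\sum_(k <- L | Q k) P (F k)) =
  (\sum_(k <- L | Q k) 2 ^ (N - size (F k)))%:R / 2 ^+ N.
Proof.
move=> leN; rewrite tau_sum => [|k]; last exact: Pword_span.
rewrite natr_sum mulr_suml big_seq_cond [RHS]big_seq_cond.
apply: eq_bigr => k /andP[/leN kN _]; rewrite tau_Pword natrX.
by rewrite expfB_cond ?pnatr_eq0 // mulrAC divff ?mul1r // expf_neq0 ?pnatr_eq0.
Qed.

(** This is the Kraft equality, cleared of denominators. *)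
Lemma partition_weight (I : eqType) (L : seq I) (F : I -> word) N :
  (forall k, k \in L -> size (F k) <= N)%N -> \sum_(k <- L) P (F k) = 1 ->
  (\sum_(k <- L) 2 ^ (N - size (F k)) = 2 ^ N)%N.
Proof.
have [_ _ tau1 _] := htau => /tau_sum_Pword h s1.
have := h xpredT; rewrite s1 tau1 => /(congr1 (fun z => z * 2 ^+ N)).
rewrite mul1r mulfVK ?expf_neq0 ?pnatr_eq0 // -natrX => /eqP.
by rewrite eqr_nat => /eqP.
Qed.

Lemma tau_table_even J : thompson_table S J -> exists m k : nat,
  [/\ tau (\sum_(t <- J | even_pair t) P t.1) = k%:R / 2 ^+ (2 * m + 1)%N,
      (0 < k <= 2 ^ (2 * m + 1))%N & (3 %| k%:Z - 2)%Z].
Proof.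
(* Any [m] for which 2m + 1 bounds all word lengths would do; the total length is one. *)
move=> tJ; pose m := (\sum_(t <- J) (size t.1 + size t.2))%N.
have le t : t \in J -> (size t.1 + size t.2 <= 2 * m + 1)%N.
  move=> tinJ; rewrite /m (big_rem t) //= mulnDr -addnA.
  by rewrite (leq_trans _ (leq_addr _ _)) ?leq_pmull.
have le1 t : t \in J -> (size t.1 <= 2 * m + 1)%N by move=> /le; lia.
have le2 t : t \in J -> (size t.2 <= 2 * m + 1)%N by move=> /le; lia.
have oddN : odd (2 * m + 1) by lia.
exists m; move: (2 * m + 1)%N oddN le1 le2 {le} => N oddN le1 le2.
pose K := (\sum_(t <- J | even_pair t) 2 ^ (N - size t.1))%N.
have w1 := partition_weight le1 (table_sum_fst tJ).
have w2 := partition_weight le2 (table_sum_snd tJ).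
(* The two Kraft equalities are added pair by pair: odd pairs contribute 0 modulo 3, even pairs
   twice the weight of their first word. As [N] is odd, 2^N = 2 modulo 3, hence also [K]. *)
have K2 : (2 * 2 ^ N = 2 * K %[mod 3])%N.
  rewrite mul2n -addnn -{1}w1 -w2 -big_split /=.
  rewrite /K big_distrr [in RHS]big_mkcond /=.
  rewrite -modn_summ -[RHS]modn_summ; congr (_ %% _)%N.
  rewrite big_seq [RHS]big_seq; apply: eq_bigr => t tinJ.
  rewrite expn2D_mod3 !oddB ?le1 ?le2 //.
  by rewrite even_pairE; do 3!case: (odd _).
have K3 : (K %% 3 = 2)%N by have := expn2_mod3 N; rewrite oddN => N2; lia.
exists K; split; first exact: tau_sum_Pword.
- apply/andP; split; first by case: (K) K3.
  by rewrite -w1 /K [leqRHS](bigID (fun t => even_pair t)) /= leq_addr.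
- by rewrite dvdz3_sub2 K3.
Qed.

Lemma D2_subspace : linear_subspace (D2 S).
Proof.
split=> [|a x y Dx Dy] B DB; have [[[B0 BL] _ _ _] _] := DB; first exact: B0.
by apply: BL; [apply: Dx|apply: Dy].
Qed.

Lemma D2_Pword w : D2 S (P w).
Proof. by apply: sub_gen_smallest; exists w. Qed.

Lemma D2_sum_Pword (I : Type) (L : seq I) (Q : pred I) (F : I -> word) :
  D2 S (\sum_(k <- L | Q k) P (F k)).
Proof.
have [D0 DL] := D2_subspace.
elim/big_rec: _ => // k x _ Dx; rewrite -[P _]scale1r; apply: DL => //.
exact: D2_Pword.
Qed.

Lemma projection_sum_Pword J (Q : pred (word * word)) : thompson_table S J ->
  projection (\sum_(t <- J | Q t) P t.1).
Proof.
move=> tJ; split.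
  by rewrite star_sum; apply: eq_bigr => t _; case: (Pword_projection t.1).
rewrite mulr_suml big_seq_cond [RHS]big_seq_cond.
apply: eq_bigr => t /andP[tinJ Qt]; rewrite mulr_sumr.
transitivity (\sum_(t' <- J | Q t') (t == t')%:R * P t.1).
  rewrite big_seq_cond [RHS]big_seq_cond; apply: eq_bigr => t' /andP[t'inJ _].
  rewrite {1 2}/Pword mulrA -(mulrA (Sw t.1)) (table_ortho_fst tJ) //.
  by case: eqP => [->|_]; rewrite ?mulr1 ?mul1r // mulr0 !mul0r.
by rewrite sum_delta ?fset_uniq // Qt.
Qed.

Lemma Omega2_sub f : thompsonF S f ->
  let p := even_part S f * star (even_part S f) in
  [/\ D2 S p, projection p &
     exists m k : nat,
       [/\ tau p = k%:R / 2 ^+ (2 * m + 1)%N,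
           (0 < k <= 2 ^ (2 * m + 1))%N & (3 %| k%:Z - 2)%Z]].
Proof.
move=> [_ [J pJ]] /=; have [tJ _] := pJ.
rewrite (even_part_table pJ) (table_sub_mul_star _ tJ).
by split; [apply: D2_sum_Pword | apply: projection_sum_Pword
          | apply: tau_table_even].
Qed.

(** * Projections of the diagonal subalgebra *)

(** These are the functions on the Cantor space of infinite words that depend on the first [n]
    letters only. *)
Definition level n (x : A) : Prop :=
  exists c : word -> R[i], x = \sum_(w <- words n) c w *: P w.

Definition cylinders : set A := [set x | exists n, level n x].

Lemma level_S n x : level n x -> level n.+1 x.
Proof.
move=> [c ->]; exists (fun w => c (take n w)).
rewrite sum_words_S big_seq [RHS]big_seq.
apply: eq_bigr => w /size_mem_words sw.
rewrite Pword_split scaler_sumr; apply: eq_bigr => i _.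
by rewrite -cats1 take_size_cat.
Qed.

Lemma level_le m n x : (m <= n)%N -> level m x -> level n x.
Proof.
by move=> /subnKC <- h; elim: (n - m)%N => [|k /level_S]; rewrite ?addn0 ?addnS.
Qed.

Lemma level_linear n a x y : level n x -> level n y -> level n (a *: x + y).
Proof.
move=> [c ->] [d ->]; exists (fun w => a * c w + d w).
rewrite scaler_sumr -big_split; apply: eq_bigr => w _ /=.
by rewrite scalerDl scalerA.
Qed.

Lemma level_mul_Pword n c w : w \in words n ->
  (\sum_(u <- words n) c u *: P u) * P w = c w *: P w.
Proof.
move=> win; rewrite mulr_suml (bigD1_seq w) ?words_uniq //= -scalerAl.
rewrite (proj2 (Pword_projection w)) big_seq_cond big1 ?addr0 //.
move=> u /andP[uin /negPf nuw].
rewrite -scalerAl Pword_ortho ?nuw ?mul0r ?scaler0 //.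
by rewrite (size_mem_words uin) (size_mem_words win).
Qed.

Lemma levelM n x y : level n x -> level n y -> level n (x * y).
Proof.
move=> [c ->] [d ->]; exists (fun w => d w * c w).
rewrite mulr_sumr big_seq [RHS]big_seq; apply: eq_bigr => w win.
by rewrite -scalerAr level_mul_Pword // scalerA.
Qed.

Lemma level_star n x : level n x -> level n (star x).
Proof.
move=> [c ->]; exists (fun w => (c w)^*); rewrite star_sum.
by apply: eq_bigr => w _; rewrite starZ (proj1 (Pword_projection w)).
Qed.

Lemma mem_words w : w \in words (size w).
Proof.
elim/last_ind: w => [|w i IH]; first by rewrite inE.
by rewrite size_rcons; apply/allpairsP; exists (w, i); rewrite mem_enum.
Qed.

Lemma level_Pword w : level (size w) (P w).
Proof.
exists (fun u => (u == w)%:R).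
rewrite (bigD1_seq w) ?mem_words ?words_uniq //= eqxx scale1r big1 ?addr0 //.
by move=> u /negPf ->; rewrite scale0r.
Qed.

(** The levels increase and each is closed under the *-algebra operations, so the closure of their
    union is a C*-subalgebra containing all P_w. *)
Lemma D2_closure_cylinders : D2 S `<=` closure cylinders.
Proof.
apply: smallest_sub; last first.
  by move=> _ [w _ <-]; apply: subset_closure; exists (size w); apply: level_Pword.
have both x y : cylinders x -> cylinders y -> exists n, level n x /\ level n y.
  move=> [m mx] [n ny]; exists (m + n)%N.
  split; first by apply: level_le mx; apply: leq_addr.
  by apply: level_le ny; apply: leq_addl.
apply: cstar_subalgebra_closure.
- split=> [|a x y /both h /h[n [nx ny]]]; last by exists n; apply: level_linear.
  by exists 0, (fun=> 0); rewrite big1 // => w _; rewrite scale0r.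
- by move=> x y /both h /h[n [nx ny]]; exists n; apply: levelM.
- by move=> x [n nx]; exists n; apply: level_star.
Qed.

Lemma Pword_comm u v : P u * P v = P v * P u.
Proof.
have sP w := proj1 (Pword_projection w).
rewrite -[in RHS](sP u) -[in RHS](sP v) -starMr.
by case: (PwordM u v) => ->; rewrite ?star0 ?sP.
Qed.

(** Taking the commutator with P_w is a Lipschitz map that vanishes on cylinder elements, hence on
    their closure. *)
Lemma D2_comm_Pword x w : D2 S x -> x * P w = P w * x.
Proof.
move=> /D2_closure_cylinders cx; apply/eqP; rewrite -subr_eq0; apply/eqP.
apply: (@image_closure_sub _ _ cylinders [set 0] (fun z => z * P w - P w * z)
  (`|P w| + `|P w|) _ _ _ x cx).
- by apply: accessible_closed_set1; apply: hausdorff_accessible;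
  apply: norm_hausdorff.
- move=> y z; have -> : y * P w - P w * y - (z * P w - P w * z)
      = (y - z) * P w - P w * (y - z).
    by rewrite mulrBl mulrBr !opprB addrACA [RHS]addrACA; congr (_ + _);
      apply: addrC.
  apply: le_trans (ler_normB _ _) _; rewrite [leRHS]mulrDl lerD //;
    last exact: normM_le.
  by rewrite mulrC normM_le.
- move=> y [n [c ->]] /=; rewrite mulr_suml mulr_sumr -sumrB big1 // => u _.
  by rewrite -scalerAl -scalerAr Pword_comm subrr.
Qed.

(** An approximant of [p] within 1/2 is a scalar on each cylinder of its level, so
    [projection_near_scalar] forces p P_w to be 0 or P_w. Raising the level to [n.*2] makes the word
    length even, as the parity count needs. *)
Lemma D2_projection_words p : D2 S p -> projection p ->
  exists n, exists M : pred word, p = \sum_(w <- words n.*2 | M w) P w.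
Proof.
move=> Dp pp; have /closure_normP h := D2_closure_cylinders Dp.
have [|d [n nd] near] := h 2^-1; first by rewrite invr_gt0.
have {nd} [c dE] : level n.*2 d by apply: level_le nd; rewrite -addnn leq_addr.
exists n, (fun w => p * P w == P w).
rewrite -[LHS]mulr1 -(sum_Pword_words n.*2) mulr_sumr [RHS]big_mkcond /=.
rewrite big_seq [RHS]big_seq; apply: eq_bigr => w win.
have [sP PP] := Pword_projection w; have [sp pp2] := pp.
have pPp : projection (p * P w).
  split; first by rewrite starMr sP sp D2_comm_Pword.
  by rewrite -mulrA (mulrA (P w)) -D2_comm_Pword // -mulrA PP mulrA pp2.
case: (@projection_near_scalar _ _ (p * P w) (P w) (c w)) => //.
- by rewrite -mulrA PP.
- by rewrite mulrA -D2_comm_Pword // -mulrA PP.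
- apply: le_lt_trans near.
  rewrite -(level_mul_Pword c win) -dE -mulrBl.
  apply: le_trans (normM_le _ _) _.
  by rewrite ler_piMr ?normr_ge0 // projection_norm_le1.
- by move=> e; rewrite e; case: eqP.
- by move=> ->; rewrite eqxx.
Qed.

(** * Realizing a prescribed projection *)

(** Both lists are sorted lexicographically and entries at equal positions are paired; order
    preservation then holds because both sides compare positions. *)
Lemma table_of_partitions (la lb : seq word) :
  uniq la -> uniq lb -> size la = size lb ->
  \sum_(w <- la) P w = 1 -> \sum_(w <- lb) P w = 1 ->
  exists J, [/\ thompson_table S J, perm_eq [seq t.1 | t <- J] la
              & perm_eq [seq t.2 | t <- J] lb].
Proof.
move=> ula ulb sab sa sb.
pose lexs (l : seq word) : seq word := sort (<=%O : rel (seqlexi 'I_2)) l.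
have plex l : perm_eq (lexs l) l by rewrite perm_sort.
have ulex l : uniq l -> uniq (lexs l) by rewrite sort_uniq.
have sz : size (lexs la) = size (lexs lb) by rewrite !size_sort.
have nthlex l (i j : nat) : uniq l ->
    (i < size (lexs l))%N -> (j < size (lexs l))%N ->
    word_lex_lt (nth [::] (lexs l) i) (nth [::] (lexs l) j) = (i < j)%N.
  move=> ul il jl; apply: (@lt_sorted_ltn_nth _ (seqlexi 'I_2)) => //.
  by rewrite sort_lt_sorted.
pose J := [fset t in zip (lexs la) (lexs lb)]%fset.
have pJ : perm_eq J (zip (lexs la) (lexs lb)).
  apply: uniq_perm; rewrite ?fset_uniq ?zip_uniql ?ulex // => t.
  by rewrite in_fset.
have p1 : perm_eq [seq t.1 | t <- J] (lexs la).
  by rewrite (perm_trans (perm_map _ pJ)) // -/(unzip1 _) unzip1_zip ?sz.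
have p2 : perm_eq [seq t.2 | t <- J] (lexs lb).
  by rewrite (perm_trans (perm_map _ pJ)) // -/(unzip2 _) unzip2_zip ?sz.
have Jnth t : t \in J -> exists2 i, (i < size (lexs la))%N &
    t = (nth [::] (lexs la) i, nth [::] (lexs lb) i).
  rewrite (perm_mem pJ) => /(nthP ([::], [::])) [i +].
  by rewrite size_zip -sz minnn => il; rewrite nth_zip // => <-; exists i.
have bij : {in J &, forall t t', t.1 = t'.1 <-> t.2 = t'.2}.
  move=> _ _ /Jnth[i il ->] /Jnth[j jl ->] /=; split=> /eqP.
    by rewrite nth_uniq ?ulex // => /eqP ->.
  by rewrite nth_uniq ?ulex -?sz // => /eqP ->.
exists J; split; [split=> //|exact: perm_trans p1 _|exact: perm_trans p2 _].
- rewrite (perm_big _ (perm_table_fst bij)).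
  by rewrite (perm_big _ (perm_trans p1 (plex la))).
- rewrite (perm_big _ (perm_table_snd bij)).
  by rewrite (perm_big _ (perm_trans p2 (plex lb))).
- move=> _ _ /Jnth[i il ->] /Jnth[j jl ->].
  by rewrite /= !nthlex // -?sz.
Qed.

(** Leaves of the 4-ary tree, with two letters per edge, in which only the rightmost leaf is
    subdivided, [n] times over. *)
Fixpoint comb n : seq word :=
  let a : 'I_2 := ord0 in let b : 'I_2 := lift ord0 ord0 in
  if n is m.+1 then
    [:: [:: a; a], [:: a; b], [:: b; a] & [seq [:: b, b & w] | w <- comb m]]
  else [:: [::]].

Lemma size_comb n : size (comb n) = (3 * n).+1.
Proof. by elim: n => //= n IH; rewrite size_map IH; lia. Qed.

Lemma comb_uniq n : uniq (comb n).
Proof.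
elim: n => //= n IH; rewrite map_inj_uniq ?IH; last by move=> u v [].
by rewrite !inE /= andbT; do ?[apply/andP; split] => //; apply/negP => /mapP[].
Qed.

Lemma comb_even n : all (fun w => ~~ odd (size w)) (comb n).
Proof.
by elim: n => //= n IH; rewrite all_map; apply: sub_all IH => w /=;
  rewrite negbK.
Qed.

Lemma sum_Pword_comb n : \sum_(w <- comb n) P w = 1.
Proof.
elim: n => [|n IH]; first by rewrite big_seq1 Pword_nil.
rewrite /= !big_cons big_map.
set b := lift ord0 ord0.
transitivity (P [:: ord0; ord0] +
    (P [:: ord0; b] + (P [:: b; ord0] + P [:: b; b]))).
  do 3!congr (_ + _).
  rewrite -[in RHS](cats0 [:: b; b]) Pword_cat Pword_nil -IH.
  rewrite mulr_sumr mulr_suml; apply: eq_bigr => w _.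
  by rewrite -(Pword_cat [:: b; b]).
rewrite -(sum_Pword_words 2) !sum_words_S big_seq1.
by rewrite !big_ord_recl !big_ord0 !addr0 !addrA.
Qed.

Lemma Omega2_sup p : D2 S p -> projection p ->
  (exists m k : nat,
     [/\ tau p = k%:R / 2 ^+ (2 * m + 1)%N,
         (0 < k <= 2 ^ (2 * m + 1))%N & (3 %| k%:Z - 2)%Z]) ->
  Omega2 S p.
Proof.
move=> Dp pp [m [k [tp _]]]; rewrite dvdz3_sub2 => /eqP k3.
have [n [M pE]] := D2_projection_words Dp pp.
pose L := words n.*2; pose c := count M L.
have sL : size L = (2 ^ n.*2)%N := size_words _.
(* The two values of the trace give k 4^n = c 2^(2m+1), which modulo 3 reads 2 = 2c. *)
have c3 : (c %% 3 = 1)%N.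
  have : tau p = c%:R / 2 ^+ n.*2.
    rewrite pE (@tau_sum_Pword _ L M (fun w => w) n.*2) =>
      [|w /size_mem_words ->//].
    congr (_%:R / _); rewrite /c -sum1_count big_seq_cond [RHS]big_seq_cond.
    by apply: eq_bigr => w /andP[/size_mem_words -> _]; rewrite subnn.
  rewrite tp => /eqP; rewrite eqr_div ?expf_neq0 ?pnatr_eq0 //.
  rewrite -!natrX -!natrM eqr_nat => /eqP /(congr1 (modn^~ 3)).
  rewrite -modnMm -[in RHS]modnMm k3 !expn2_mod3 odd_double.
  have -> : odd (2 * m + 1) by lia.
  by lia.
(* Words of [M] keep their even length; the others are split once, so that their children have odd
   length. *)
pose la := [seq w <- L | M w] ++
  [seq rcons w i | w <- [seq w <- L | ~~ M w], i <- enum 'I_2].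
have ula : uniq la.
  rewrite cat_uniq filter_uniq ?words_uniq //=; apply/andP; split.
    apply/hasPn => _ /allpairsP[[w i] /= [+ _ ->]].
    rewrite !mem_filter => /andP[_ /size_mem_words sw]; apply/negP => /andP[_].
    by move=> /size_mem_words; rewrite size_rcons sw; lia.
  apply: allpairs_uniq (enum_uniq _) _;
    first by rewrite filter_uniq ?words_uniq.
  by move=> [u i] [v j] _ _ /= /rcons_inj[-> ->].
have sumla : \sum_(w <- la) P w = 1.
  rewrite big_cat big_allpairs_dep /= !big_filter -(sum_Pword_words n.*2).
  rewrite [RHS](bigID M) /=; congr (_ + _); apply: eq_bigr => w _.
  by rewrite big_enum Pword_split.
(* The length is c + 2(4^n - c) = 2 * 4^n - c, which is 2 - 1 = 1 modulo 3. *)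
have sla : size la = (3 * (size la %/ 3)).+1.
  have : size la = (c + (2 ^ n.*2 - c) * 2)%N.
    rewrite size_cat size_allpairs size_enum_ord !size_filter -/c;
      congr (_ + _ * _)%N.
    by rewrite -sL -(count_predC M L) addKn.
  have : (c <= 2 ^ n.*2)%N by rewrite -sL count_size.
  have := expn2_mod3 n.*2; rewrite odd_double; lia.
have [|J [tJ p1 p2]] := table_of_partitions ula (comb_uniq (size la %/ 3)) _
  sumla (sum_Pword_comb _).
  by rewrite size_comb.
have pJ : presents S J (table_sum S J) by [].
exists (table_sum S J).
  split; last by exists J.
  split.
    by rewrite (table_sub_star_mul xpredT tJ) table_sum_snd.
  by rewrite (table_sub_mul_star xpredT tJ) table_sum_fst.
rewrite (even_part_table pJ) (table_sub_mul_star _ tJ) pE.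
(* All second coordinates come from the comb and have even length, so a pair is even exactly when
   its first word is; this selects [M] from [la]. *)
transitivity (\sum_(w <- [seq t.1 | t <- J] | ~~ odd (size w)) P w).
  rewrite big_map big_seq_cond [RHS]big_seq_cond; apply: eq_bigl => t.
  apply: andb_id2l => tinJ; rewrite even_pairE.
  have /(allP (comb_even _)) : t.2 \in comb (size la %/ 3).
    by rewrite -(perm_mem p2) map_f.
  by move=> /negbTE ->; rewrite eqbF_neg.
rewrite (perm_big _ p1) big_mkcond big_cat big_allpairs_dep /= !big_filter.
rewrite [X in _ + X]big_seq_cond [X in _ + X]big1 =>
  [|w /andP[/size_mem_words sw _]].
  rewrite addr0 big_seq_cond [RHS]big_seq_cond; apply: eq_bigr => w.
  by move=> /andP[/size_mem_words -> _]; rewrite odd_double.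
by rewrite big1 // => i _; rewrite size_rcons sw /= odd_double.
Qed.

End Trace.
End CuntzWords.

Theorem theorem2p3 (R : realType) (A : cstarAlgType R) (S : 'I_2 -> A)
    (tau : A -> R[i]) (hS : is_cuntz2 S)
    (htau : normalized_trace (F2 S) tau) :
  Omega2 S =
  [set p : A | [/\ D2 S p, projection p &
     exists m k : nat,
       [/\ tau p = k%:R / 2 ^+ (2 * m + 1)%N,
           (0 < k <= 2 ^ (2 * m + 1))%N
         & (3 %| k%:Z - 2)%Z]]].
Proof.
apply/seteqP; split=> [_ [f Ff <-]|p [Dp pp tp]].
  exact: (Omega2_sub hS htau Ff).
exact: (Omega2_sup hS htau Dp pp tp).
Qed.
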